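(* Let $\mathcal{M}_1=(V,\mathcal{I}_1)$ and $\mathcal{M}_2=(V,\mathcal{I}_2)$ be two matroids of rank $k$ on the same finite ground set $V$ without loops, and let $\beta,\beta^-$ be integers with $\beta\ge\beta^-+7$. Then a $(\beta,\beta^-)$-DCS of $\mathcal{M}_1,\mathcal{M}_2$ exists, and it can be computed using at most $2\beta^2\mu(V)$ local improvement steps, where a local improvement step on the current set $V'$ (starting from $V'=\emptyset$) either removes from $V'$ an element $v\in V'$ with $\tilde\rho_{\mathcal{M}_1}(v)+\tilde\rho_{\mathcal{M}_2}(v)>\beta$, or, if no such element exists, inserts into $V'$ an element $v\in V\setminus V'$ with $\tilde\rho_{\mathcal{M}_1}(v)+\tilde\rho_{\mathcal{M}_2}(v)<\beta^-$ (associated densities taken with respect to the current $V'$).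
   Context: $\mu(V)$ is the maximum cardinality of a set in $\mathcal{I}_1\cap\mathcal{I}_2$. For a matroid $\mathcal{M}$ and $U\subseteq V$, $\rho_{\mathcal{M}}(U)=|U|/\mathrm{rank}_{\mathcal{M}}(U)$, with $\rho_{\mathcal{M}}(\emptyset)=0$ and $+\infty$ for nonempty rank-$0$ sets. $\mathcal{M}|V'$ is the restriction; $\mathcal{M}/U$ is the contraction (ground set $V\setminus U$, independent sets $S$ with $S\cup B_U$ independent for a maximal independent $B_U\subseteq U$). Density-based decomposition of $V'$ in a matroid $\mathcal{M}$ of rank $k$: with $\mathcal{M}'=\mathcal{M}|V'$, for $j=1,\dots,k$, $U_j$ is the largest-cardinality subset among the maximum-density subsets of $V'\setminus(U_1\cup\dots\cup U_{j-1})$ in $\mathcal{M}'/(U_1\cup\dots\cup U_{j-1})$. Associated density of $v\in V$ w.r.t. $V'$: $\tilde\rho_{\mathcal{M}}(v)=\rho_{\mathcal{M}'/(U_1\cup\dots\cup U_{j-1})}(U_j)$ for the least $j$ with $v\in\mathrm{span}_{\mathcal{M}}(U_1\cup\dots\cup U_j)$ if $v\in\mathrm{span}_{\mathcal{M}}(V')$, and $0$ otherwise. $V'$ is a $(\beta,\beta^-)$-DCS if (i) $\tilde\rho_{\mathcal{M}_1}(v)+\tilde\rho_{\mathcal{M}_2}(v)\le\beta$ for all $v\in V'$ and (ii) $\tilde\rho_{\mathcal{M}_1}(v)+\tilde\rho_{\mathcal{M}_2}(v)\ge\beta^-$ for all $v\in V\setminus V'$, densities w.r.t. $V'$. *)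

(* Defs.v *)
From HB Require Import structures.
From mathcomp Require Import all_boot all_order all_algebra.
From mathcomp Require Import constructive_ereal.

Set Implicit Arguments.
Unset Strict Implicit.
Unset Printing Implicit Defensive.

Import Order.TTheory GRing.Theory Num.Theory.

(* The ground set is a field, a subset of the carrier [V], so that
   restrictions and contractions are again matroids over the same type. *)
Record matroid (V : finType) := Matroid {
  ground : {set V};
  indep : {set {set V}};
  indep_ground : forall S, S \in indep -> S \subset ground;
  indep0 : set0 \in indep;
  indepS : forall S T : {set V}, S \subset T -> T \in indep -> S \in indep;
  indep_aug : forall S T : {set V}, S \in indep -> T \in indep -> #|S| < #|T| ->
    exists2 x, x \in T :\: S & x |: S \in indep
}.

Definition mrank (V : finType) (M : matroid V) (U : {set V}) : nat :=
  \max_(S in indep M | S \subset U) #|S|.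

Definition mspan (V : finType) (M : matroid V) (U : {set V}) : {set V} :=
  [set v in ground M | mrank M (v |: U) == mrank M U].

Definition loopless (V : finType) (M : matroid V) : Prop :=
  forall v, v \in ground M -> [set v] \in indep M.

Definition restrict_indep (V : finType) (M : matroid V) (W : {set V}) :
    {set {set V}} :=
  [set S in indep M | S \subset W].

Lemma restrict_ground (V : finType) (M : matroid V) (W S : {set V}) :
  S \in restrict_indep M W -> S \subset ground M :&: W.
Proof. by rewrite inE subsetI => /andP[/indep_ground-> ->]. Qed.

Lemma restrict_indep0 (V : finType) (M : matroid V) (W : {set V}) :
  set0 \in restrict_indep M W.
Proof. by rewrite inE indep0 sub0set. Qed.

Lemma restrict_indepS (V : finType) (M : matroid V) (W S T : {set V}) :
  S \subset T -> T \in restrict_indep M W -> S \in restrict_indep M W.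
Proof.
move=> sST; rewrite !inE => /andP[iT sTW].
by rewrite (indepS sST iT) (subset_trans sST sTW).
Qed.

Lemma restrict_aug (V : finType) (M : matroid V) (W S T : {set V}) :
    S \in restrict_indep M W -> T \in restrict_indep M W -> #|S| < #|T| ->
  exists2 x, x \in T :\: S & x |: S \in restrict_indep M W.
Proof.
rewrite !inE => /andP[iS sSW] /andP[iT sTW] /(indep_aug iS iT)[x xTS ixS].
exists x => //; rewrite inE ixS subUset sub1set sSW andbT.
by move: xTS; rewrite inE => /andP[_ /(subsetP sTW)].
Qed.

Definition restrict (V : finType) (M : matroid V) (W : {set V}) : matroid V :=
  Matroid (@restrict_ground V M W) (restrict_indep0 M W)
    (@restrict_indepS V M W) (@restrict_aug V M W).

Definition mbasis (V : finType) (M : matroid V) (U B : {set V}) : bool :=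
  maxset [pred S : {set V} | (S \subset U) && (S \in indep M)] B.

Definition contract_indep (V : finType) (M : matroid V) (U : {set V}) :
    {set {set V}} :=
  [set S : {set V} | (S \subset ground M :\: U) &&
     [exists B : {set V}, mbasis M U B && (S :|: B \in indep M)]].

Lemma mbasis_exists (V : finType) (M : matroid V) (U : {set V}) :
  exists B, mbasis M U B.
Proof.
have [|B mB _] := @maxset_exists _
  [pred S : {set V} | (S \subset U) && (S \in indep M)] set0.
  by rewrite /= sub0set indep0.
by exists B.
Qed.

Lemma indep_extend (V : finType) (M : matroid V) (S T : {set V}) :
    S \in indep M -> T \in indep M -> #|S| <= #|T| ->
  exists C : {set V},
    [/\ S \subset C, C \subset S :|: T, C \in indep M & #|C| = #|T|].
Proof.
move=> iS iT; move: {2}(#|T| - #|S|) (erefl (#|T| - #|S|)) => n.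
elim: n S iS => [|n IHn] S iS.
  move/eqP; rewrite subn_eq0 => leTS leST.
  by exists S; rewrite subxx subsetUl iS; split=> //; apply/eqP; rewrite eqn_leq leST.
move=> Dn _; have ltST: #|S| < #|T| by rewrite -subn_gt0 Dn.
have [x /setDP[xT xNS] ixS] := indep_aug iS iT ltST.
have cxS: #|x |: S| = #|S|.+1 by rewrite cardsU1 xNS.
have [||C [sC sCT iC cC]] := IHn _ ixS.
- by rewrite cxS subnS Dn.
- by rewrite cxS.
exists C; split=> //; first exact: subset_trans (subsetUr _ _) sC.
apply: subset_trans sCT _; rewrite !subUset sub1set inE xT orbT.
by rewrite subsetUl subsetUr.
Qed.

Lemma mbasisP (V : finType) (M : matroid V) (U B : {set V}) :
  reflect [/\ B \subset U, B \in indep M &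
    forall C : {set V}, C \subset U -> C \in indep M -> B \subset C -> C = B]
   (mbasis M U B).
Proof.
apply: (iffP maxsetP) => [[/andP[sBU iB] mB]|[sBU iB mB]]; split=> //.
- by move=> C sCU iC; apply: mB; rewrite /= sCU.
- by rewrite /= sBU.
- by move=> C /andP[sCU iC]; apply: mB.
Qed.

Lemma mbasis_leq (V : finType) (M : matroid V) (U B C : {set V}) :
  mbasis M U B -> C \subset U -> C \in indep M -> #|C| <= #|B|.
Proof.
case/mbasisP=> sBU iB mB sCU iC; rewrite leqNgt; apply/negP=> ltBC.
have [x /setDP[xC /negP xNB] ixB] := indep_aug iB iC ltBC.
case: xNB; rewrite -(mB _ _ ixB (subsetUr _ _)) ?setU11 //.
by rewrite subUset sub1set (subsetP sCU).
Qed.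

(* Independence in a contraction does not depend on the chosen basis of [U]. *)
Lemma contract_basis (V : finType) (M : matroid V) (U B C S : {set V}) :
    mbasis M U B -> mbasis M U C -> [disjoint S & U] ->
  S :|: B \in indep M -> S :|: C \in indep M.
Proof.
move=> bB bC dSU iSB.
have [sBU iB _] := mbasisP _ _ _ bB; have [sCU iC mC] := mbasisP _ _ _ bC.
have cBC: #|B| = #|C|.
  by apply/eqP; rewrite eqn_leq (mbasis_leq bC) ?(mbasis_leq bB).
have dSB: [disjoint S & B] by rewrite disjoint_sym (disjointWl sBU) // disjoint_sym.
have dSC: [disjoint S & C] by rewrite disjoint_sym (disjointWl sCU) // disjoint_sym.
have cSB: #|S :|: B| = #|S :|: C|.
  by rewrite !cardsU !disjoint_setI0 // cBC.
have [|D [sCD sDS iD cD]] := indep_extend iC iSB.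
  by rewrite cSB subset_leq_card ?subsetUr.
suff sD: D \subset S :|: C.
  have /eqP <- : D == S :|: C by rewrite eqEcard sD cD cSB leqnn.
  exact: iD.
apply/subsetP=> x xD; rewrite inE.
have := subsetP sDS x xD; rewrite !inE.
case/orP=> [->|/orP[->//|xB]]; first by rewrite orbT.
rewrite -(mC (D :&: U)) ?subsetIr //; first by rewrite inE xD (subsetP sBU) ?orbT.
  exact: indepS (subsetIl _ _) iD.
by rewrite subsetI sCD.
Qed.

Lemma contract_ground (V : finType) (M : matroid V) (U S : {set V}) :
  S \in contract_indep M U -> S \subset ground M :\: U.
Proof. by rewrite inE => /andP[]. Qed.

Lemma contract_indep0 (V : finType) (M : matroid V) (U : {set V}) :
  set0 \in contract_indep M U.
Proof.
rewrite inE sub0set; have [B bB] := mbasis_exists M U.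
by apply/existsP; exists B; rewrite bB set0U; case/mbasisP: bB.
Qed.

Lemma contract_indepS (V : finType) (M : matroid V) (U S T : {set V}) :
  S \subset T -> T \in contract_indep M U -> S \in contract_indep M U.
Proof.
move=> sST; rewrite !inE => /andP[sT /existsP[B /andP[bB iT]]].
rewrite (subset_trans sST) //; apply/existsP; exists B; rewrite bB.
exact: indepS (setSU _ sST) iT.
Qed.

Lemma contract_aug (V : finType) (M : matroid V) (U S T : {set V}) :
    S \in contract_indep M U -> T \in contract_indep M U -> #|S| < #|T| ->
  exists2 x, x \in T :\: S & x |: S \in contract_indep M U.
Proof.
rewrite !inE => /andP[sS /existsP[B /andP[bB iS]]].
case/andP=> sT /existsP[C /andP[bC iT]] ltST.
have disjU (X : {set V}) : X \subset ground M :\: U -> [disjoint X & U].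
  by rewrite subsetD => /andP[].
have{C bC} iT := contract_basis bC bB (disjU _ sT) iT.
have [sBU _ _] := mbasisP _ _ _ bB.
have disjB (X : {set V}) : X \subset ground M :\: U -> X :&: B = set0.
  move/disjU => dX; apply: disjoint_setI0.
  by rewrite disjoint_sym (disjointWl sBU) // disjoint_sym.
have [|x] := indep_aug iS iT.
  by rewrite !cardsU !disjB // cards0 !subn0 ltn_add2r.
rewrite !inE negb_or => /andP[/andP[xNS xNB]].
rewrite (negbTE xNB) orbF => xT ixS; exists x; first by rewrite inE xNS.
rewrite inE subUset sub1set (subsetP sT) // sS; apply/existsP; exists B.
by rewrite bB -setUA.
Qed.

Definition contract (V : finType) (M : matroid V) (U : {set V}) : matroid V :=
  Matroid (@contract_ground V M U) (contract_indep0 M U)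
    (@contract_indepS V M U) (@contract_aug V M U).

Definition density (V : finType) (M : matroid V) (U : {set V}) : \bar rat :=
  if U == set0 then 0%:E%R
  else if mrank M U == 0 then +oo%E
  else (#|U|%:R / (mrank M U)%:R)%:E%R.

Definition max_density (V : finType) (M : matroid V) (U : {set V}) : bool :=
  (U \subset ground M) &&
  [forall W : {set V}, (W \subset ground M) ==> (density M W <= density M U)%E].

(* The maximum-density subset of largest cardinality (it is unique). *)
Definition densest (V : finType) (M : matroid V) : {set V} :=
  odflt set0 [pick U | max_density M U &&
    [forall W : {set V}, max_density M W ==> (#|W| <= #|U|)]].

(* [dec_union M W j] is U_1 :|: ... :|: U_j, and [dec_part M W j] is U_{j+1}. *)
Fixpoint dec_union (V : finType) (M : matroid V) (W : {set V}) (j : nat) :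
    {set V} :=
  if j is i.+1 then
    dec_union M W i :|: densest (contract (restrict M W) (dec_union M W i))
  else set0.

Definition dec_part (V : finType) (M : matroid V) (W : {set V}) (j : nat) :
    {set V} :=
  densest (contract (restrict M W) (dec_union M W j)).

(* For [v] in the span of [W], [i.+1] is the least j in 1..k, k the rank of [M],
   with [v] in the span of U_1 :|: ... :|: U_j. *)
Definition assoc_density (V : finType) (M : matroid V) (W : {set V}) (v : V) :
    \bar rat :=
  if v \in mspan M W then
    let i := find (fun j => v \in mspan M (dec_union M W j))
                  (iota 1 (mrank M (ground M))) in
    density (contract (restrict M W) (dec_union M W i)) (dec_part M W i)
  else 0%:E%R.

Definition sum_density (V : finType) (M1 M2 : matroid V) (W : {set V}) (v : V) :
    \bar rat :=
  (assoc_density M1 W v + assoc_density M2 W v)%E.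

(* The two matroids are meant to have ground set [setT]. *)
Definition is_DCS (V : finType) (M1 M2 : matroid V) (beta betam : int)
    (W : {set V}) : Prop :=
  (forall v, v \in W -> (sum_density M1 M2 W v <= (beta%:~R)%R%:E)%E) /\
  (forall v, v \notin W -> ((betam%:~R)%R%:E <= sum_density M1 M2 W v)%E).

Definition common_rank (V : finType) (M1 M2 : matroid V) : nat :=
  \max_(S in indep M1 :&: indep M2) #|S|.

Definition overfull (V : finType) (M1 M2 : matroid V) (beta : int)
    (W : {set V}) (v : V) : bool :=
  (v \in W) && ((beta%:~R)%R%:E < sum_density M1 M2 W v)%E.

Definition underfull (V : finType) (M1 M2 : matroid V) (betam : int)
    (W : {set V}) (v : V) : bool :=
  (v \notin W) && (sum_density M1 M2 W v < (betam%:~R)%R%:E)%E.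

Definition local_step (V : finType) (M1 M2 : matroid V) (beta betam : int) :
    rel {set V} :=
  fun W W' =>
    [exists v, overfull M1 M2 beta W v && (W' == W :\ v)]
    || ([forall v, ~~ overfull M1 M2 beta W v]
        && [exists v, underfull M1 M2 betam W v && (W' == v |: W)]).

(* Main.v *)
(* A potential argument.  For a matroid with rank function r and an integer
   level l >= 1, let g_l(W) be the maximum of |U| - l r(U) over U included in W.
   Inserting v in W changes g_l by 0 or 1.  If v has density rho with respect
   to W, uncrossing with the unions D_i of the first i parts of the
   decomposition shows that insertion leaves g_l unchanged when l >= rho + 1,
   and that removal lowers g_l by 1 when l <= rho - 1.  With N = beta - 3 and
   G the sum of g_1, ..., g_N over both matroids, the integer
   (N - 1) |W| - G(W) therefore increases with each local step.  It starts at 0.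
   If I is a largest common independent set, then W is the union of a set
   spanned by I in the first matroid and a set spanned by I in the second,
   so the potential is at most N |W| - G(W) <= 2 N^2 |I|. *)

Require Import Defs.
From mathcomp Require Import all_boot all_order all_algebra.
From mathcomp Require Import constructive_ereal.
From mathcomp Require Import zify lra.

Import Order.TTheory GRing.Theory Num.Theory.

Set Implicit Arguments.
Unset Strict Implicit.
Unset Printing Implicit Defensive.

(* [constructive_ereal] has a [contract] of its own. *)
Local Notation contract := Defs.contract.

(** * Rank in a matroid, its contractions and its restrictions *)

Section Rank.

Variables (V : finType) (M : matroid V).
Implicit Types (A B S T U W X : {set V}) (v : V).

Lemma leq_mrank S U : S \in indep M -> S \subset U -> #|S| <= mrank M U.
Proof.
move=> iS sSU.
by rewrite /mrank (@leq_bigmax_cond _ _ (fun S : {set V} => #|S|)) ?iS. Qed.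

Lemma mrank_mbasis U B : mbasis M U B -> mrank M U = #|B|.
Proof.
move=> bB; have [sBU iB _] := mbasisP _ _ _ bB.
apply/eqP; rewrite eqn_leq leq_mrank // andbT.
by apply/bigmax_leqP=> S /andP[iS sSU]; apply: mbasis_leq bB sSU iS.
Qed.

Lemma mrank_witness U :
  exists B : {set V}, [/\ B \subset U, B \in indep M & #|B| = mrank M U].
Proof.
have [B bB] := mbasis_exists M U; exists B; rewrite (mrank_mbasis bB).
by case/mbasisP: bB.
Qed.

Lemma mrankS A B : A \subset B -> mrank M A <= mrank M B.
Proof.
move=> sAB; have [S [sSA iS <-]] := mrank_witness A.
by rewrite leq_mrank // (subset_trans sSA).
Qed.

Lemma mrank_card U : mrank M U <= #|U|.
Proof. by have [S [sSU _ <-]] := mrank_witness U; rewrite subset_leq_card. Qed.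

Lemma mrank0 : mrank M set0 = 0.
Proof. by apply/eqP; rewrite -leqn0 -(cards0 V) mrank_card. Qed.

Lemma mrank_indep S : S \in indep M -> mrank M S = #|S|.
Proof. by move=> iS; apply/eqP; rewrite eqn_leq mrank_card leq_mrank. Qed.

Lemma extend_basis S U :
  S \in indep M -> S \subset U ->
  exists C : {set V}, [/\ S \subset C, C \subset U, C \in indep M & #|C| = mrank M U].
Proof.
move=> iS sSU; have [B [sBU iB cB]] := mrank_witness U.
have [|C [sSC sC iC cC]] := indep_extend iS iB; first by rewrite cB leq_mrank.
exists C; split=> //; last by rewrite cC.
by rewrite (subset_trans sC) // subUset sSU.
Qed.

(** A basis [I] of the intersection extends to a basis [J] of the union; the traces of [J] on [A]
    and [B] are independent and share [I]. *)
Lemma mrank_submod A B :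
  mrank M (A :|: B) + mrank M (A :&: B) <= mrank M A + mrank M B.
Proof.
have [I [sI iI <-]] := mrank_witness (A :&: B).
have [|J [sIJ sJ iJ <-]] := extend_basis (U := A :|: B) iI.
  by rewrite (subset_trans sI) // subIset // subsetUl.
have iJX X : J :&: X \in indep M by apply: indepS iJ; apply: subsetIl.
have hA : #|J :&: A| <= mrank M A by rewrite leq_mrank // subsetIr.
have hB : #|J :&: B| <= mrank M B by rewrite leq_mrank // subsetIr.
apply: leq_trans (leq_add hA hB).
rewrite -(cardsUI (J :&: A)) -setIUr (setIidPl sJ) leq_add2l.
by rewrite subset_leq_card // setIACA setIid subsetI sIJ.
Qed.

Lemma mrank_contract A X :
  X \subset ground M :\: A ->
  mrank (contract M A) X = mrank M (A :|: X) - mrank M A.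
Proof.
move=> sX; have [B bB] := mbasis_exists M A.
have [sBA iB mB] := mbasisP _ _ _ bB.
have rA := mrank_mbasis bB.
apply/eqP; rewrite eqn_leq; apply/andP; split.
  apply/bigmax_leqP=> S /andP[]; rewrite inE => /andP[sS /existsP[C /andP[bC iSC]]] sSX.
  have dSA : [disjoint S & A] by move: sS; rewrite subsetD => /andP[].
  have iSB := contract_basis bC bB dSA iSC.
  have dSB : [disjoint S & B] by rewrite disjoint_sym (disjointWl sBA) // disjoint_sym.
  have -> : #|S| = #|S :|: B| - mrank M A.
    by rewrite cardsU disjoint_setI0 // cards0 rA; lia.
  by rewrite leq_sub2r // leq_mrank // setUC setUSS.
have [|C [sBC sC iC <-]] := extend_basis (U := A :|: X) iB.
  by rewrite (subset_trans sBA) // subsetUl.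
have eB : C :&: A = B.
  apply: mB; rewrite ?subsetIr ?subsetI ?sBC //.
  exact: indepS (subsetIl _ _) iC.
have -> : #|C| - mrank M A = #|C :\: A| by rewrite -(cardsID A C) eB rA addKn.
have sCX : C :\: A \subset X by rewrite subDset.
apply: leq_bigmax_cond; rewrite sCX andbT inE (subset_trans sCX sX) /=.
apply/existsP; exists B; rewrite bB /= -eB.
by rewrite setUC setID.
Qed.

Lemma mrank_restrict W X : X \subset W -> mrank (restrict M W) X = mrank M X.
Proof.
move=> sXW; rewrite /mrank; apply: eq_bigl => S; rewrite inE.
by have [/subset_trans-> //|] := boolP (S \subset X); rewrite ?andbF ?andbT.
Qed.

End Rank.

(** * Existence of a densest set *)

Section Densest.

Variables (V : finType) (M : matroid V).
Implicit Types (U W : {set V}).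

(** The default value in [densest] is never taken: densities are totally ordered and the sets are
    finite in number. *)
Lemma densest_max : max_density M (densest M).
Proof.
rewrite /densest; case: pickP => [U /andP[]//|noU].
have [U0 sU0 mU0] : exists2 U0 : {set V}, U0 \subset ground M &
    forall W, W \subset ground M -> (density M W <= density M U0)%E.
  have P0 : [pred U : {set V} | U \subset ground M] set0 by rewrite /= sub0set.
  by case: (Order.TotalTheory.arg_maxP (density M) P0) => U sU mU; exists U.
have m0 : max_density M U0.
  by rewrite /max_density sU0; apply/forallP=> W; apply/implyP; apply: mU0.
case: (arg_maxnP (fun U : {set V} => #|U|) m0) => U mU cU.
have /negP[] := negbT (noU U); rewrite mU; apply/forallP=> W.
by apply/implyP; apply: cU.
Qed.

Lemma densest_sub : densest M \subset ground M.
Proof. by case/andP: densest_max. Qed.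

Lemma densest_ge W : W \subset ground M ->
  (density M W <= density M (densest M))%E.
Proof. by case/andP: densest_max => _ /forallP/(_ W)/implyP. Qed.

End Densest.

(** * The density-based decomposition *)

Section Decomposition.

Variables (V : finType) (M : matroid V).
Hypothesis groundM : ground M = [set: V].
Hypothesis looplessM : loopless M.
Implicit Types (A B D S T U W X : {set V}) (v w : V).

Local Notation r := (mrank M).
Local Notation quo W D := (contract (restrict M W) D).

(** [D] is a flat of the restriction to [W]. Contracting a flat creates no loops, which keeps all
    densities finite. *)
Definition closed_in W D :=
  D \subset W /\ forall w, w \in W -> r (w |: D) = r D -> w \in D.

Lemma mem_mspan v U : (v \in mspan M U) = (r (v |: U) == r U).
Proof. by rewrite inE groundM inE. Qed.

Lemma mem_sub_mspan v U : v \in U -> v \in mspan M U.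
Proof. by move=> vU; rewrite mem_mspan (setUidPr _) ?sub1set. Qed.

Lemma mspan0 v : v \notin mspan M set0.
Proof.
rewrite mem_mspan setU0 mrank0 mrank_indep ?cards1 //.
by apply: looplessM; rewrite groundM inE.
Qed.

Lemma closed_in0 W : closed_in W set0.
Proof.
split=> [|w _ /eqP]; first exact: sub0set.
by rewrite -mem_mspan (negPf (mspan0 w)).
Qed.

Lemma ground_quo W D : ground (quo W D) = W :\: D.
Proof. by rewrite /= groundM setTI. Qed.

Lemma closed_in_mrank_lt W D X :
  closed_in W D -> X \subset W :\: D -> X != set0 -> r D < r (D :|: X).
Proof.
move=> [sDW cD] sX /set0Pn[x xX].
have := subsetP sX x xX; rewrite inE => /andP[xND xW].
rewrite (@leq_trans (r (x |: D))) //; last first.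
  by apply: mrankS; rewrite setUC setUS // sub1set.
rewrite ltn_neqAle (mrankS _ (subsetUr _ _)) andbT eq_sym.
by apply: contra xND => /eqP; apply: cD.
Qed.

Lemma density_quo W D X :
  closed_in W D -> X \subset W :\: D ->
  density (quo W D) X = ((#|X|%:R / (r (D :|: X) - r D)%:R)%R%:E)%E.
Proof.
move=> cD sX; rewrite /density.
(* For empty [X] the quotient is 0 / 0, which is 0 here, as the density is. *)
have [->|nX] := eqVneq X set0; first by rewrite cards0 mul0r.
have sDW := cD.1; have sXW : X \subset W by rewrite (subset_trans sX) ?subsetDl.
rewrite mrank_contract; last by rewrite -(ground_quo W D) in sX.
rewrite !mrank_restrict // ?subUset ?sDW // subn_eq0 leqNgt.
by rewrite (closed_in_mrank_lt cD).
Qed.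

(** One step of the decomposition, with optimality multiplied out. The new union is again a flat: a
    further element spanned by it could join [U] without raising the rank, and the density would
    grow. An empty [U] forces [D = W], since a nonempty remainder has positive density. *)
Lemma densest_quo W D (U := densest (quo W D)) :
  closed_in W D ->
  exists rho : rat,
  [/\ density (quo W D) U = (rho%:E)%E, (0 <= rho)%R,
      [/\ U \subset W :\: D, closed_in W (D :|: U) & U = set0 -> D = W],
      (#|U|%:R = rho * ((r (D :|: U))%:R - (r D)%:R))%R
    & forall T, T \subset W ->
      (#|T :\: D|%:R <= rho * ((r (D :|: T))%:R - (r D)%:R))%R].
Proof.
move=> cD; have [sDW clD] := cD.
have sU : U \subset W :\: D by rewrite -ground_quo densest_sub.
have dens X (X_W : X \subset W :\: D) := density_quo cD X_W.
have ltr X : X \subset W :\: D -> X != set0 ->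
    (0 < (r (D :|: X) - r D)%:R :> rat)%R.
  by move=> sX nX; rewrite ltr0n subn_gt0 (closed_in_mrank_lt cD).
have subE X : ((r (D :|: X) - r D)%:R = (r (D :|: X))%:R - (r D)%:R :> rat)%R.
  by rewrite natrB // mrankS // subsetUl.
have maxU X : X \subset W :\: D ->
   (#|X|%:R / (r (D :|: X) - r D)%:R <=
    #|U|%:R / (r (D :|: U) - r D)%:R :> rat)%R.
  by move=> sX; rewrite -lee_fin -!dens // densest_ge // ground_quo.
set rho := (#|U|%:R / _)%R in maxU.
have cardU : (#|U|%:R = rho * ((r (D :|: U))%:R - (r D)%:R))%R.
  rewrite -subE /rho; have [->|nU] := eqVneq U set0.
    by rewrite setU0 subnn cards0 mulr0.
  by rewrite mulfVK // gt_eqF ?ltr.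
exists rho; split => //.
- exact: dens.
- by rewrite divr_ge0 ?ler0n.
- split=> //; last first.
    move=> U0; apply/eqP; rewrite eqEsubset sDW -setD_eq0; apply/negPn/negP=> nW.
    have := maxU _ (subxx _); rewrite /rho U0 cards0 mul0r leNgt => /negP[].
    by rewrite divr_gt0 ?ltr // ltr0n card_gt0.
  split=> [|w wW rw].
    by rewrite subUset sDW (subset_trans sU) // subsetDl.
  rewrite inE; apply/norP=> -[wD wU].
  have sU' : w |: U \subset W :\: D by rewrite subUset sU andbT sub1set inE wD.
  have nU' : w |: U != set0 by apply/set0Pn; exists w; rewrite setU11.
  have := maxU _ sU'; have := ltr _ sU' nU'.
  rewrite /rho setUCA rw cardsU1 wU => gt0.
  by rewrite ler_pM2r ?invr_gt0 // ler_nat ltnn.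
- move=> T sTW.
  have sT : T :\: D \subset W :\: D by rewrite setSD.
  have eT : D :|: (T :\: D) = D :|: T by rewrite setDE setUIr setUCr setIT.
  have := maxU _ sT; have [->|nT] := eqVneq (T :\: D) set0.
    rewrite cards0 -subE => _; rewrite mulr_ge0 ?ler0n //.
    by rewrite divr_ge0 ?ler0n.
  by rewrite ler_pdivrMr ?ltr // subE eT.
Qed.

Lemma dec_union_closed W j : closed_in W (dec_union M W j).
Proof.
elim: j => [|j IHj]; first exact: closed_in0.
by have [rho [_ _ [_ ? _] _ _]] := densest_quo IHj.
Qed.

Lemma dec_union_sub W j : dec_union M W j \subset W.
Proof. by case: (dec_union_closed W j). Qed.

(** Over a flat each nonempty part raises the rank, and an empty part means that [W] is
    exhausted. *)
Lemma dec_union_rank W j : dec_union M W j = W \/ j <= r (dec_union M W j).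
Proof.
elim: j => [|j IHj]; first by right.
have cD := dec_union_closed W j.
have [rho [_ _ [sU cU U0] _ _]] := densest_quo cD.
case: IHj => [DW|leD].
  left; apply/eqP; rewrite eqEsubset dec_union_sub /=.
  by rewrite -{1}DW subsetUl.
have [U1|nU] := eqVneq (densest (quo W (dec_union M W j))) set0.
  by left; rewrite /= U1 setU0 U0.
by right; apply: leq_ltn_trans leD _; apply: closed_in_mrank_lt cD sU nU.
Qed.

Lemma dec_union_span W v :
  v \in mspan M W -> v \in mspan M (dec_union M W (r (ground M))).
Proof.
move=> vW; have [->//|ler] := dec_union_rank W (r (ground M)).
rewrite mem_mspan eqn_leq [X in _ && X]mrankS ?subsetUr // andbT.
by rewrite (leq_trans _ ler) // groundM mrankS // subsetT.
Qed.

(** The hypothesis on [D] is applied to [D :&: T] and the optimality of [U] to [T]; submodularity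
    for [D] and [T] combines the two bounds. *)
Lemma dense_union (rho : rat) D U :
    (0 <= rho)%R ->
    (forall T, T \subset D ->
      (rho * ((r D)%:R - (r T)%:R) <= #|D :\: T|%:R)%R) ->
    [disjoint D & U] ->
    (#|U|%:R = rho * ((r (D :|: U))%:R - (r D)%:R))%R ->
    (forall T, T \subset D :|: U ->
      (#|T :\: D|%:R <= rho * ((r (D :|: T))%:R - (r D)%:R))%R) ->
  forall T, T \subset D :|: U ->
    (rho * ((r (D :|: U))%:R - (r T)%:R) <= #|(D :|: U) :\: T|%:R)%R.
Proof.
move=> rho0 dD dDU cU maxU T sT.
have h1 := dD _ (subsetIl D T); have h2 := maxU _ sT.
have cDU := cardsUI D U; rewrite disjoint_setI0 // cards0 addn0 in cDU.
have h3 : ((r (D :|: T))%:R + (r (D :&: T))%:R <= (r D)%:R + (r T)%:R :> rat)%R.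
  by rewrite -!natrD ler_nat mrank_submod.
have h4 : (#|(D :|: U) :\: T| + #|T :\: D| = #|D :\: (D :&: T)| + #|U|)%N.
  have e1 := cardsID (D :|: U) T; have e2 := cardsID T (D :|: U).
  have e3 := cardsID (D :&: T) D; have e4 := cardsID D T.
  move: e1 e2 e3 e4.
  rewrite (setIidPl sT) ![(D :|: U) :&: T]setIC (setIidPl sT) setIA setIid.
  rewrite [T :&: D]setIC; lia.
have {}h4 := congr1 (fun n => n%:R : rat)%R h4; rewrite !natrD in h4.
have h5 := ler_wpM2l rho0 h3; lra.
Qed.

(** Induction by [dense_union], which wants the same [rho] for the old union and the new part. The
    bound for the old union carries over because densities never increase along the
    decomposition. *)
Lemma dec_union_dense W j (D := dec_union M W j) (D' := dec_union M W j.+1)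
    (rho : rat) T :
  density (quo W D) (dec_part M W j) = (rho%:E)%E -> T \subset D' ->
  (rho * ((r D')%:R - (r T)%:R) <= #|D' :\: T|%:R)%R.
Proof.
move=> dU; rewrite {}/D'; move: T.
have step i (rho1 : rat) : let D1 := dec_union M W i in
    density (quo W D1) (dec_part M W i) = (rho1%:E)%E ->
    (forall T, T \subset D1 ->
      (rho1 * ((r D1)%:R - (r T)%:R) <= #|D1 :\: T|%:R)%R) ->
  forall T, T \subset dec_union M W i.+1 ->
    (rho1 * ((r (dec_union M W i.+1))%:R - (r T)%:R)
       <= #|dec_union M W i.+1 :\: T|%:R)%R.
  move=> D1; rewrite /dec_part {}/D1.
  have [rho' [-> rho0 [sU _ _] cU maxU]] := densest_quo (dec_union_closed W i).
  case=> <- dD; apply: dense_union => //.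
    by move: sU; rewrite subsetD disjoint_sym => /andP[].
  by move=> T sT; rewrite maxU // (subset_trans sT) ?(dec_union_sub W i.+1).
apply: (step) => //; rewrite {}/D in dU *.
elim: j rho dU => [|j IHj] rho dU T sT.
  by move: sT; rewrite subset0 => /eqP->; rewrite subrr mulr0 ler0n.
have [rho0 [dU0 rho0_ge0 [sU0 _ _] cU0 maxU0]] := densest_quo (dec_union_closed W j).
have [rho1 [dU1 rho1_ge0 [sU1 cU1 U1_0] eqU1 _]] :=
  densest_quo (dec_union_closed W j.+1).
move: dU; rewrite /dec_part dU1 => -[<-].
apply: le_trans (step _ _ dU0 (IHj _ dU0) _ sT).
(* What remains is [rho1 <= rho0]. Were it false, the parts [U0] and [U1] together would be denser
   over [D] than [U0]. *)
rewrite ler_wpM2r ?subr_ge0 ?ler_nat ?mrankS //.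
set D := dec_union M W j in sU0 cU0 maxU0 *.
set D1 := dec_union M W j.+1 in sU1 eqU1 cU1 dU1 *.
set U1 := densest _ in sU1 eqU1 cU1 dU1.
have [U1e|nU1] := eqVneq U1 set0.
  by move: dU1; rewrite U1e /density eqxx => -[<-].
have lt1 := closed_in_mrank_lt (dec_union_closed W j.+1) sU1 nU1.
rewrite -/D1 in lt1.
have eD1 : D :|: densest (quo W D) = D1 by [].
rewrite eD1 in cU0.
clearbody U1; clear step IHj dU0 dU1 U1_0.
set U0 := densest _ in sU0 cU0 eD1; clearbody U0 D1.
have sDD1 : D \subset D1 by rewrite -eD1 subsetUl.
have dD1U1 : D1 :&: U1 = set0.
  by apply: disjoint_setI0; move: sU1; rewrite subsetD disjoint_sym => /andP[].
have := maxU0 _ cU1.1; rewrite setUA (setUidPr sDD1) setDUl.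
have -> : D1 :\: D = U0.
  rewrite -eD1 setDUl setDv set0U; apply/setDidPl.
  by move: sU0; rewrite subsetD => /andP[].
have -> : U1 :\: D = U1.
  apply/setDidPl; rewrite disjoint_sym (disjointWl sDD1) //.
  by rewrite -setI_eq0 dD1U1.
rewrite cardsU (_ : _ :&: _ = set0) ?cards0 ?subn0; last first.
  by apply/eqP; rewrite -subset0 -dD1U1 setSI // -eD1 subsetUr.
rewrite natrD cU0 eqU1 => le01.
have gt0 : (0 < (r (D1 :|: U1))%:R - (r D1)%:R :> rat)%R by rewrite subr_gt0 ltr_nat.
by rewrite -(ler_pM2r gt0); lra.
Qed.

(** All that the potential argument uses of the decomposition. The first witness is the union of the
    parts before the one at which [v] becomes spanned, the second includes that part. Outside the
    span of [W], the density is 0 and [W] is the first witness. *)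
Lemma assoc_densityP W v :
  exists2 rho : rat, assoc_density M W v = (rho%:E)%E &
  [/\ (0 <= rho)%R,
    exists D, [/\ D \subset W, v \notin mspan M D &
     forall T, T \subset W ->
      (#|T :\: D|%:R <= rho * ((r (D :|: T))%:R - (r D)%:R))%R] &
    v \in W -> exists D, [/\ D \subset W, v \in D &
     forall T, T \subset D ->
      (rho * ((r D)%:R - (r T)%:R) <= #|D :\: T|%:R)%R]].
Proof.
rewrite /assoc_density; case: ifP => [vW|/negbT vW]; last first.
  exists 0%R => //; split=> //.
    exists W; split=> // T sTW; rewrite mul0r.
    by move: sTW; rewrite -setD_eq0 => /eqP->; rewrite cards0.
  by move/mem_sub_mspan; rewrite (negPf vW).
set P := fun j => v \in mspan M (dec_union M W j).
set s := iota 1 (r (ground M)); cbv zeta; set i := find P s.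
have [rho [dU rho0 [sU cU _] _ maxU]] := densest_quo (dec_union_closed W i).
exists rho; first exact: dU.
split=> //.
  exists (dec_union M W i); split=> //; first exact: dec_union_sub.
  case Di : i => [|j]; first exact: mspan0.
  (* Position [j] of [s] holds the index [j.+1], which is [i], so minimality of [find] says that the
     first [i] parts do not span [v]. *)
  have lt_js : j < find P s by rewrite -/i Di.
  have := before_find 0 lt_js; rewrite /P nth_iota ?add1n; first by move=> ->.
  by rewrite (leq_trans lt_js) // -[X in _ <= X](size_iota 1) find_size.
move=> vinW; exists (dec_union M W i.+1); split; first exact: dec_union_sub.
  have hasP : has P s.
    apply/hasP; exists (r (ground M)); last exact: dec_union_span.
    rewrite mem_iota add1n leqnn andbT lt0n; apply/eqP=> r0.
    have := dec_union_span vW; rewrite r0 /= => v0.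
    by rewrite (negPf (mspan0 v)) in v0.
  have := nth_find 0 hasP; rewrite /P nth_iota; last first.
    by rewrite -(size_iota 1 (r (ground M))) -has_find.
  rewrite add1n mem_mspan => /eqP; have [_] := dec_union_closed W i.+1; exact.
move=> T; exact: dec_union_dense.
Qed.

(** * Excess at a level, under insertion and removal *)

(* The truncated subtraction is harmless, since [U = set0] already gives 0. *)
Definition excess l W := \max_(U : {set V} | U \subset W) (#|U| - l * r U).

Lemma leq_excess l U W : U \subset W -> #|U| <= excess l W + l * r U.
Proof.
move=> sUW; rewrite addnC -leq_subLR.
exact: (@leq_bigmax_cond _ _ (fun U : {set V} => #|U| - l * r U)).
Qed.

Lemma excess_leP l W n :
  (forall U, U \subset W -> #|U| <= n + l * r U) -> excess l W <= n.
Proof.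
move=> le_n; apply/bigmax_leqP=> U sUW.
by rewrite leq_subLR addnC le_n.
Qed.

Lemma excess_witness l W :
  exists2 U : {set V}, U \subset W & #|U| = excess l W + l * r U.
Proof.
have [|U sUW] := @eq_bigmax_cond _ [pred U : {set V} | U \subset W]
    (fun U : {set V} => #|U| - l * r U).
  by apply/card_gt0P; exists set0; rewrite inE sub0set.
rewrite -/(excess l W) => exU.
have [e0|] := posnP (excess l W); last by exists U => //; lia.
by exists set0; rewrite ?sub0set // cards0 mrank0 e0 muln0.
Qed.

Lemma excess0 l : excess l set0 = 0.
Proof.
apply/eqP; rewrite -leqn0; apply: excess_leP => U.
by rewrite subset0 => /eqP->; rewrite cards0.
Qed.

Lemma excessS l W W' : W \subset W' -> excess l W <= excess l W'.
Proof.
by move=> sW; apply: excess_leP => U sU; apply/leq_excess/(subset_trans sU).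
Qed.

Lemma excessU1 l v W : excess l (v |: W) <= (excess l W).+1.
Proof.
apply: excess_leP => U; rewrite -subDset => sU.
have := leq_excess l sU; have := mrankS M (subsetDl U [set v]).
have := cardsD1 v U; have := leq_b1 (v \in U); nia.
Qed.

(** Split a set [X] containing [v] along [D]. Its elements outside [D] other than [v] number at most
    [l - 1] per unit of rank that [X] adds to [D]. At least one unit is added because [D] does not
    span [v], which leaves room for [v]. The rest, [X :&: D], lies in [W]. *)
Lemma excess_insert l W v (rho : rat) :
  assoc_density M W v = (rho%:E)%E -> (rho + 1 <= l%:R)%R ->
  excess l (v |: W) <= excess l W.
Proof.
have [rho' -> [rho0 [D [sDW vD maxD]] _]] := assoc_densityP W v.
case=> rhoE; subst rho' => le_l.
apply: excess_leP => X sX; have [vX|nvX] := boolP (v \in X); last first.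
  apply: leq_excess; apply/subsetP=> x xX; have := subsetP sX x xX.
  by case/setU1P=> // xv; rewrite -xv xX in nvX.
set U := X :\ v.
have sUW : U \subset W by rewrite subDset.
have nvD : v \notin D by apply: contra vD; apply: mem_sub_mspan.
have sXD : X :&: D \subset W by rewrite subIset // sDW orbT.
have UD : U :&: D = X :&: D.
  by rewrite setIDAC; apply/setDidPl; rewrite disjoint_sym disjoints1;
  rewrite inE negb_and nvD orbT.
have cX : #|X| = (#|U :\: D| + #|X :&: D|).+1.
  by rewrite (cardsD1 v X) vX -/U -(cardsID D U) UD; lia.
have subm := mrank_submod M X D.
have le1 : r (D :|: U) <= r (X :|: D) by rewrite setUC mrankS // setSU // subsetDl.
have lt1 : r D < r (X :|: D).
  apply: (@leq_trans (r (v |: D))); last by rewrite mrankS // setSU // sub1set.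
  rewrite ltn_neqAle (mrankS _ (subsetUr _ _)) andbT eq_sym.
  by rewrite -mem_mspan.
have leDU : r D <= r (D :|: U) by rewrite mrankS // subsetUl.
have {}maxD : #|U :\: D| + (r (D :|: U) - r D) <= l * (r (D :|: U) - r D).
  have := maxD _ sUW; rewrite -natrB // => leU.
  rewrite -(ler_nat rat) natrD natrM.
  have := ler_wpM2r (ler0n rat (r (D :|: U) - r D)) le_l; lra.
have l_gt0 : 0 < l by rewrite -(ltr_nat rat); lra.
have := leq_excess l sXD; rewrite cX.
nia.
Qed.

(** Joining the dense set [S] to an optimal [T] of [W :\ v] adds at least [l + 1] elements per unit
    of rank, and at least [v] if the rank does not grow, so [S :|: T] beats [T]. *)
Lemma excess_remove l W v (rho : rat) :
  assoc_density M W v = (rho%:E)%E -> v \in W -> (l%:R + 1 <= rho)%R ->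
  excess l (W :\ v) < excess l W.
Proof.
have [rho' -> [rho0 _ remW]] := assoc_densityP W v.
case=> rhoE; subst rho' => /remW[S [sSW vS minS]] le_l.
have [T sT cT] := excess_witness l (W :\ v).
have nvT : v \notin T.
  by apply: contraL sT => vT; apply/subsetPn; exists v; rewrite // !inE eqxx.
have sSTW : S :|: T \subset W by rewrite subUset sSW (subset_trans sT) ?subsetDl.
have := leq_excess l sSTW.
have cST : #|S :|: T| = #|T| + #|S :\: T|.
  by rewrite setUC cardsU; have := cardsID T S; rewrite setIC; lia.
have subm := mrank_submod M S T.
have leS : r (S :&: T) <= r S by rewrite mrankS // subsetIl.
have gt0 : 0 < #|S :\: T| by apply/card_gt0P; exists v; rewrite inE nvT.
have {}minS : (l + 1) * (r S - r (S :&: T)) <= #|S :\: T|.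
  have := minS _ (subsetIl S T); rewrite setDIr setDv set0U -natrB // => leU.
  rewrite -(ler_nat rat) natrM natrD.
  by have := ler_wpM2r (ler0n rat (r S - r (S :&: T))) le_l; lra.
nia.
Qed.

Definition total_excess n W := \sum_(i < n) excess i.+1 W.

Lemma mrank_mspan I A : I \in indep M -> A \subset mspan M I -> r A <= #|I|.
Proof.
move=> iI sA; have [C [sIC sC iC cC]] := extend_basis iI (subsetUl I A).
apply: leq_trans (mrankS M (subsetUr I A)) _; rewrite -cC subset_leq_card //.
apply/subsetP=> x xC; apply/negPn/negP=> nxI.
have /setUP[xI|xA] := subsetP sC x xC; first by rewrite xI in nxI.
have := subsetP sA x xA; rewrite mem_mspan mrank_indep.
  by rewrite mrank_indep // cardsU1 nxI; lia.
by apply: indepS iC; rewrite subUset sub1set xC.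
Qed.

Lemma indepU1 I v : I \in indep M -> v \notin mspan M I -> v |: I \in indep M.
Proof.
move=> iI; rewrite mem_mspan => rvI.
have lt_r : r I < r (v |: I) by rewrite ltn_neqAle eq_sym rvI mrankS // subsetUr.
have [B [sB iB cB]] := mrank_witness M (v |: I).
suff <- : B = v |: I by [].
apply/eqP; rewrite eqEcard sB cB.
apply: leq_trans lt_r; rewrite mrank_indep // cardsU1.
by have := leq_b1 (v \notin I); lia.
Qed.

(** [A] competes at each of the [n] levels, and each level is at most [n]; hence the factor
    [n ^ 2]. *)
Lemma total_excess_ge n I A W :
  I \in indep M -> A \subset mspan M I -> A \subset W ->
  n * #|A| <= total_excess n W + n ^ 2 * #|I|.
Proof.
move=> iI sA sAW; have rA := mrank_mspan iI sA.
rewrite expnS expn1 -mulnA -[X in X * #|A|]card_ord -[X in _ + X * _]card_ord.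
rewrite -!sum_nat_const -big_split /=; apply: leq_sum => i _.
apply: leq_trans (leq_excess i.+1 sAW) _; rewrite leq_add2l.
by apply: leq_mul.
Qed.

End Decomposition.

(** * The potential of the two matroids and the number of steps *)

Section Potential.

Variables (V : finType) (M1 M2 : matroid V).
Hypothesis ground1 : ground M1 = [set: V].
Hypothesis ground2 : ground M2 = [set: V].
Hypothesis loopless1 : loopless M1.
Hypothesis loopless2 : loopless M2.
Implicit Types (W : {set V}) (v : V) (p : nat).

Let n_ex n W := total_excess M1 n W + total_excess M2 n W.

Lemma total_excess_bound n W :
  n * #|W| <= n_ex n W + 2 * n ^ 2 * common_rank M1 M2.
Proof.
have [|I] := @eq_bigmax_cond _ (mem (indep M1 :&: indep M2))
    (fun S : {set V} => #|S|).
  by apply/card_gt0P; exists set0; rewrite !inE !indep0.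
rewrite -/(common_rank M1 M2) inE => /andP[iI1 iI2] cI.
(* An element outside both spans could be added to the largest common independent set [I]. *)
have span12 v : v \notin mspan M1 I -> v \in mspan M2 I.
  move=> nv1; apply/negPn/negP=> nv2.
  have : #|v |: I| <= common_rank M1 M2.
    by apply: leq_bigmax_cond; rewrite inE !indepU1.
  rewrite cI cardsU1; case: (boolP (v \in I)) => [vI|]; last by lia.
  by rewrite mem_sub_mspan in nv1.
have := total_excess_ge ground1 n iI1 (subsetIr W _) (subsetIl W _).
have s2 : W :\: mspan M1 I \subset mspan M2 I.
  by apply/subsetP=> v; rewrite inE => /andP[/span12].
have := total_excess_ge ground2 n iI2 s2 (subsetDl W _).
rewrite -(cardsID (mspan M1 I) W) /n_ex cI; lia.
Qed.

Lemma sum_densityP W v :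
  exists rho : rat * rat,
  [/\ assoc_density M1 W v = ((rho.1)%:E)%E, assoc_density M2 W v = ((rho.2)%:E)%E,
      sum_density M1 M2 W v = ((rho.1 + rho.2)%:E)%E,
      (0 <= rho.1)%R & (0 <= rho.2)%R].
Proof.
have [r1 e1 [r1_ge0 _ _]] := assoc_densityP ground1 loopless1 W v.
have [r2 e2 [r2_ge0 _ _]] := assoc_densityP ground2 loopless2 W v.
by exists (r1, r2); split; rewrite //= /sum_density e1 e2 EFinD.
Qed.

(* The level [i.+1] of the first matroid is paired with the level [n - i] of
   the second, so that the two levels add up to [n.+1]. *)
Lemma n_exE n W :
  n_ex n W = \sum_(i < n) (excess M1 i.+1 W + excess M2 (n - i) W).
Proof.
rewrite big_split /n_ex; congr (_ + _).
rewrite [LHS](reindex_inj rev_ord_inj); apply: eq_bigr => i _ /=.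
by rewrite subnSK.
Qed.

(** Here N is [p + 2], and paired levels add up to [p + 3]. If neither were at least 1 below its
    density, the densities would sum to less than [p + 5]. So each of the N pairs drops. *)
Lemma overfull_n_ex p W v :
  overfull M1 M2 (p + 5)%:Z W v -> n_ex p.+2 (W :\ v) + p.+2 <= n_ex p.+2 W.
Proof.
case/andP=> vW; have [[r1 r2] /= [e1 e2 -> _ _]] := sum_densityP W v.
rewrite lte_fin => lt_r.
rewrite !n_exE -[X in _ + X <= _]muln1 -[X in _ + X * _]card_ord.
rewrite -sum_nat_const -big_split /=; apply: leq_sum => i _.
have sW := subsetDl W [set v].
have [le1|lt1] := lerP (i.+1%:R + 1)%R r1.
  have := excess_remove ground1 loopless1 e1 vW le1.
  have := excessS M2 (p.+2 - i) sW; lia.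
have [le2|lt2] := lerP ((p.+2 - i)%:R + 1)%R r2.
  have := excess_remove ground2 loopless2 e2 vW le2.
  have := excessS M1 i.+1 sW; lia.
exfalso; clear e1 e2; have ei : (i.+1 + (p.+2 - i) + 2 = p + 5)%N by have := ltn_ord i; lia.
have {}ei := congr1 (fun n => n%:R : rat)%R ei; rewrite !natrD in ei.
rewrite -pmulrn natrD in lt_r; lra.
Qed.

(** The levels [p + 1] and [p + 2] are too high to rise in either matroid. The others pair up to sum
    [p + 1], which is too much for both members of a pair to rise. *)
Lemma underfull_n_ex p W v (betam : int) :
  underfull M1 M2 betam W v -> (betam + 2 <= p%:Z)%R ->
  n_ex p.+2 (v |: W) <= n_ex p.+2 W + p.
Proof.
case/andP=> vW; have [[r1 r2] /= [e1 e2 -> r1_ge0 r2_ge0]] := sum_densityP W v.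
rewrite lte_fin => lt_r le_p.
have ins1 l : (r1 + 1 <= l%:R)%R -> excess M1 l (v |: W) <= excess M1 l W.
  exact: excess_insert.
have ins2 l : (r2 + 1 <= l%:R)%R -> excess M2 l (v |: W) <= excess M2 l W.
  exact: excess_insert.
clear e1 e2.
have {}lt_r : (r1 + r2 + 2 < p%:R)%R.
  have : ((betam + 2)%:~R <= p%:Z%:~R :> rat)%R by rewrite ler_int.
  rewrite intrD -pmulrn; lra.
have top l : p < l -> (r1 + 1 <= l%:R)%R /\ (r2 + 1 <= l%:R)%R.
  rewrite -(ltr_nat rat) => lt_p; split; lra.
have [[a1 a2] [b1 b2]] := (top _ (ltnSn p), top _ (ltnW (ltnSn p.+1))).
suff : n_ex p (v |: W) <= n_ex p W + p.
  rewrite /n_ex /total_excess !big_ord_recr /=.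
  move: (ins1 _ a1) (ins2 _ a2) (ins1 _ b1) (ins2 _ b2); lia.
rewrite !n_exE -[X in _ <= _ + X]muln1 -[X in _ <= _ + X * _]card_ord.
rewrite -sum_nat_const -big_split /=; apply: leq_sum => i _.
have [le1|lt1] := lerP (r1 + 1)%R (i.+1%:R).
  have := ins1 _ le1; have := excessU1 M2 (p - i) v W; lia.
have [le2|lt2] := lerP (r2 + 1)%R ((p - i)%:R).
  have := ins2 _ le2; have := excessU1 M1 i.+1 v W; lia.
exfalso; have ei : (i.+1 + (p - i) = p + 1)%N by have := ltn_ord i; lia.
have {}ei := congr1 (fun n => n%:R : rat)%R ei; rewrite !natrD in ei.
lra.
Qed.

(** A removal costs [p + 1] in the cardinality term and wins [p + 2] in the excess; an insertion
    wins [p + 1] and costs at most [p]. *)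
Lemma local_step_n_ex p (betam : int) W W' :
  (betam + 2 <= p%:Z)%R -> local_step M1 M2 (p + 5)%:Z betam W W' ->
  n_ex p.+2 W' + p.+1 * #|W| < n_ex p.+2 W + p.+1 * #|W'|.
Proof.
move=> le_p /orP[/existsP[v /andP[ov /eqP->]]|
  /andP[_ /existsP[v /andP[un /eqP->]]]].
  have vW : v \in W by case/andP: ov.
  have := overfull_n_ex ov; rewrite (cardsD1 v W) vW; nia.
have vW : v \notin W by case/andP: un.
have := underfull_n_ex un le_p; rewrite cardsU1 vW; nia.
Qed.

Lemma path_n_ex p (betam : int) W s :
  (betam + 2 <= p%:Z)%R -> path (local_step M1 M2 (p + 5)%:Z betam) W s ->
  n_ex p.+2 (last W s) + p.+1 * #|W| + size s
    <= n_ex p.+2 W + p.+1 * #|last W s|.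
Proof.
move=> le_p; elim: s W => [|W' s IHs] W /=; first by rewrite addn0.
case/andP=> /(local_step_n_ex le_p) lt_W /IHs; lia.
Qed.

Lemma path_size_bound (beta betam : int) s :
  (betam + 7 <= beta)%R -> path (local_step M1 M2 beta betam) set0 s ->
  ((size s)%:Z <= 2 * beta ^+ 2 * (common_rank M1 M2)%:Z)%R.
Proof.
(* For [betam <= 0] no step leaves the empty set, as densities are nonnegative. Otherwise [beta] is
   at least 8 and [beta - 5] is a natural number [p]. *)
move=> gap; have [le0|gt0] := lerP betam 0%R.
  case: s => [|W s] /=; first by move=> _; have := sqr_ge0 beta; nia.
  case/andP=> /orP[/existsP[v]|/andP[_ /existsP[v]]].
    by rewrite /overfull inE.
  rewrite /underfull; have [[r1 r2] /= [_ _ -> r1_ge0 r2_ge0]] := sum_densityP set0 v.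
  rewrite lte_fin => /andP[/andP[_ lt_r] _]; exfalso.
  have : (betam%:~R <= 0 :> rat)%R by rewrite lerz0.
  lra.
have [p Dp] : exists p : nat, (beta = (p + 5)%N%:Z)%R.
  by exists (absz (beta - 5)%R); lia.
rewrite {}Dp in gap * => s_path.
have le_p : (betam + 2 <= p%:Z)%R by lia.
have := path_n_ex le_p s_path; have := total_excess_bound p.+2 (last set0 s).
have -> : n_ex p.+2 set0 = 0.
  by rewrite n_exE big1 // => i _; rewrite !excess0.
rewrite cards0; nia.
Qed.

Lemma terminal_DCS (beta betam : int) W :
  (forall W', ~~ local_step M1 M2 beta betam W W') ->
  is_DCS M1 M2 beta betam W.
Proof.
move=> noW; have no_over v : ~~ overfull M1 M2 beta W v.
  apply: contra (noW (W :\ v)) => ov; apply/orP; left.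
  by apply/existsP; exists v; rewrite ov eqxx.
split=> v vW; rewrite leNgt; apply/negP=> lt_v.
  by have := no_over v; rewrite /overfull vW lt_v.
have /negP[] := noW (v |: W); apply/orP; right; apply/andP; split.
  exact/forallP.
by apply/existsP; exists v; rewrite /underfull vW lt_v eqxx.
Qed.

End Potential.

(** A path that never gets stuck would reach length [|b| + 1], which the bound excludes. *)
Lemma bounded_path_terminal (T : finType) (e : rel T) (x : T) (b : int) :
  (forall s, path e x s -> ((size s)%:Z <= b)%R) ->
  exists2 s, path e x s & forall y, ~~ e (last x s) y.
Proof.
move=> bnd.
have ext k : (exists2 s, path e x s & forall y, ~~ e (last x s) y) \/
    exists2 s, path e x s & size s = k.
  elim: k => [|k [|[s xs sz]]]; [by right; exists [::] | by left |].
  have [/existsP[y exy]|/existsPn no_y] := boolP [exists y, e (last x s) y].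
    by right; exists (rcons s y); rewrite ?rcons_path ?xs ?size_rcons ?sz.
  by left; exists s.
have [//|[s xs sz]] := ext `|b|%N.+1.
have := bnd s xs; rewrite sz; lia.
Qed.

Theorem theorem23 (V : finType) (M1 M2 : matroid V) (k : nat)
    (beta betam : int)
    (ground1 : ground M1 = [set: V]) (ground2 : ground M2 = [set: V])
    (rank1 : mrank M1 [set: V] = k) (rank2 : mrank M2 [set: V] = k)
    (loopless1 : loopless M1) (loopless2 : loopless M2)
    (gap : (betam + 7 <= beta)%R) :
  (exists W : {set V}, is_DCS M1 M2 beta betam W) /\
  (exists s : seq {set V},
     [/\ path (local_step M1 M2 beta betam) set0 s,
         is_DCS M1 M2 beta betam (last set0 s)
       & ((size s)%:Z <= 2 * beta ^+ 2 * (common_rank M1 M2)%:Z)%R]) /\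
  (forall s : seq {set V},
     path (local_step M1 M2 beta betam) set0 s ->
     ((size s)%:Z <= 2 * beta ^+ 2 * (common_rank M1 M2)%:Z)%R /\
     ((forall W : {set V}, ~~ local_step M1 M2 beta betam (last set0 s) W) ->
        is_DCS M1 M2 beta betam (last set0 s))).
Proof.
have bnd s := path_size_bound ground1 ground2 loopless1 loopless2 (s := s) gap.
have [s s_path /terminal_DCS dcs] := bounded_path_terminal bnd.
split; first by exists (last set0 s).
split; first by exists s; split=> //; apply: bnd.
by move=> t t_path; split; [apply: bnd | apply: terminal_DCS].
Qed.
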